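(* Let $\mathcal{X}\subset\mathbb{R}^D$ be compact, let $\mathcal{Y}$ be a mark space and $\Theta$ a parameter space. Consider a Neyman-Scott process with gamma weights: latent events $\{(m_l,w_l,\theta_l)\}_{l=1}^L$ are drawn from a Poisson process on $\mathcal{X}\times\mathbb{R}_+\times\Theta$ with intensity $\nu(m,w,\theta)=\overline{L}(\mathcal{X})\,\mathrm{Ga}(w\mid\alpha,\beta)\,p(m,\theta)$, where $\overline{L}(\mathcal{X})>0$, $\alpha,\beta>0$ and $p(m,\theta)$ is a probability density (so $L\sim\mathrm{Po}(\overline{L}(\mathcal{X}))$); given the latent events, observed points $\{(x_n,y_n)\}_{n=1}^N$ are drawn from a Poisson process on $\mathcal{X}\times\mathcal{Y}$ with intensity $\sum_{l=1}^L w_l\,p(x,y\mid m_l,\theta_l)$, each $p(\cdot,\cdot\mid m,\theta)$ being a probability density. Label the observed points $1,\dots,N$ in uniformly random order and let $\mathcal{C}$ be the partition of $[N]=\{1,\dots,N\}$ into nonempty blocks grouping points with the same parent latent event. Then, integrating over the latent event locations, weights and parameters, the joint probability of the (random) number of points $N$ and the partition $\mathcal{C}$ is $$p(N,\mathcal{C})=V_{N,|\mathcal{C}|}\prod_{\mathcal{C}_k\in\mathcal{C}}\frac{\Gamma(|\mathcal{C}_k|+\alpha)}{\Gamma(\alpha)},$$ where $|\mathcal{C}|$ is the number of blocks, $|\mathcal{C}_k|$ the size of block $\mathcal{C}_k$, $N=\sum_k|\mathcal{C}_k|$, and $$V_{N,|\mathcal{C}|}=\frac{1}{N!}\left(\frac{1}{1+\beta}\right)^N\sum_{L=|\mathcal{C}|}^\infty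 \mathrm{Po}(L\mid\overline{L}(\mathcal{X}))\,\frac{L!}{(L-|\mathcal{C}|)!}\left(\frac{\beta}{1+\beta}\right)^{L\alpha}.$$
   Context: $\mathrm{Ga}(w\mid\alpha,\beta)$ is the gamma density with shape $\alpha$ and rate $\beta$; $\mathrm{Po}(L\mid\mu)$ is the Poisson pmf with mean $\mu$. The parent of an observed point is the latent event whose impulse response generated it (by Poisson superposition, the observed process is the union of independent Poisson processes with intensities $w_l\,p(x,y\mid m_l,\theta_l)$). *)

(* Defs.v *)
From HB Require Import structures.
From mathcomp Require Import all_boot all_order all_algebra.
From mathcomp Require Import all_classical all_reals all_analysis.
Set Implicit Arguments. Unset Strict Implicit. Unset Printing Implicit Defensive.
Import Order.TTheory GRing.Theory Num.Theory.
Import numFieldNormedType.Exports.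
Local Open Scope classical_set_scope.
Local Open Scope ring_scope.

Section NSP.
Context {R : realType}.

Definition Gamma (s : R) : R :=
  fine (\int[lebesgue_measure]_(t in `]0%R, +oo[) (t `^ (s - 1) * expR (- t))%:E)%E.

Definition gamma_pdf (alpha beta w : R) : R :=
  beta `^ alpha / Gamma alpha * w `^ (alpha - 1) * expR (- (beta * w)).

Definition Po (r : R) (k : nat) : R := expR (- r) * r ^+ k / k`!%:R.

(* Total mass of the impulse response  int p(x,y | t) d(x,y)  of a latent
   event with (location, parameter) t. *)
Definition mass {dT dS} {T : measurableType dT} {S : measurableType dS}
  (nu : {measure set S -> \bar R}) (k : T -> S -> R) (t : T) : R :=
  fine (\int[nu]_s (k t s)%:E)%E.

(* Integral over the L i.i.d. latent events (w_l, t_l), t_l = (m_l, theta_l),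
   with density Ga(w | alpha, beta) * p(t); the integrand f receives the list
   of total intensities w_l * mass(t_l) of the L offspring Poisson processes. *)
Fixpoint latent_int {dT dS} {T : measurableType dT} {S : measurableType dS}
  (mu : {measure set T -> \bar R}) (nu : {measure set S -> \bar R})
  (p : T -> R) (k : T -> S -> R) (alpha beta : R)
  (L : nat) (f : seq R -> \bar R) : \bar R :=
  match L with
  | 0 => f [::]
  | L'.+1 =>
    (\int[lebesgue_measure]_(w in `]0%R, +oo[)
      \int[mu]_t ((gamma_pdf alpha beta w * p t)%:E *
         latent_int mu nu p k alpha beta L' (fun s => f ((w * mass nu k t)%R :: s))))%E
  end.

(* Observed points, given counts n_l of offspring of latent event l:
   the points are the pairs (l, j) with j < n_l. *)
Definition pts (L N : nat) (n : {ffun 'I_L -> 'I_N.+1}) : finType :=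
  {i : 'I_L & 'I_(n i)}.

Definition induced (L N : nat) (n : {ffun 'I_L -> 'I_N.+1})
  (f : {ffun pts n -> 'I_N}) : {set {set 'I_N}} :=
  [set f @: [set x : pts n | tag x == i] | i : 'I_L] :\ finset.set0.

(* Given L latent events whose offspring processes have total intensities
   a_0,...,a_(L-1): probability that N points are observed and that the
   uniformly random labeling (a uniformly random bijection points -> [N])
   yields the partition C. *)
Definition obs_prob (L N : nat) (C : {set {set 'I_N}}) (a : seq R) : R :=
  \sum_(n : {ffun 'I_L -> 'I_N.+1} | (\sum_(i < L) (n i : nat))%N == N)
    ((\prod_(i < L) Po a`_i (n i)) *
     (#|[set f : {ffun pts n -> 'I_N} | injectiveb f && (induced f == C)]|%:R
        / N`!%:R)).

(* Joint probability p(N, C) in the Neyman-Scott process with gamma weights: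
   L ~ Po(Lbar); latent events i.i.d. with density Ga(w|alpha,beta) p(t);
   observed points = superposition of independent Poisson processes with
   intensities w_l p(x,y | t_l). *)
Definition pNC {dT dS} {T : measurableType dT} {S : measurableType dS}
  (mu : {measure set T -> \bar R}) (nu : {measure set S -> \bar R})
  (p : T -> R) (k : T -> S -> R) (Lbar alpha beta : R)
  (N : nat) (C : {set {set 'I_N}}) : \bar R :=
  (\sum_(L <oo) ((Po Lbar L)%:E *
     latent_int mu nu p k alpha beta L (fun a => (obs_prob L C a)%:E)))%E.

Definition V_coef (Lbar alpha beta : R) (N K : nat) : \bar R :=
  ((N`!%:R^-1 * (1 / (1 + beta)) ^+ N)%:E *
   \sum_(K <= L <oo) (Po Lbar L * (L`!%:R / (L - K)`!%:R) *
                       (beta / (1 + beta)) `^ (L%:R * alpha))%:E)%E.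

End NSP.

(* Main.v *)
(** Every impulse response has total mass 1, so the locations and parameters
    integrate out, and each latent event contributes the Gamma-Poisson marginal
    of its number of offspring, [q^alpha r^n Gamma(n + alpha) / (Gamma(alpha) n!)]
    with [q = beta / (1 + beta)] and [r = 1 / (1 + beta)].  A labelling of the
    points that induces [C] amounts to a parent map [z : [N] -> [L]] whose
    nonempty fibers are the blocks of [C], together with an ordering of each
    fiber; the orderings cancel the factors [1 / n!], and there are
    [L! / (L - |C|)!] such parent maps, one for each injection of the blocks
    into the latent events. *)
Require Import Defs.
From HB Require Import structures.
From mathcomp Require Import all_boot all_order all_algebra.
From mathcomp Require Import all_classical all_reals all_analysis.
From mathcomp Require Import measurable_realfun ring.
Import Order.TTheory GRing.Theory Num.Theory.
Import numFieldNormedType.Exports.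
Local Open Scope ring_scope.

(* The counting set of [obs_prob] and the preimages in [induced] are classical
   sets, used as finite predicates. *)
Lemma mem_mkset_bool {T : Type} (b : pred T) x : (x \in mkset b) = b x.
Proof. by apply/idP/idP; rewrite in_setE. Qed.

(** * Counting the labelings that induce a given partition *)

Section labelings.
Variables (L N : nat).
Implicit Types (C : {set {set 'I_N}}) (z : {ffun 'I_N -> 'I_L}).

Definition fiber z i : {set 'I_N} := [set x | z x == i].

Definition fibers z : {set {set 'I_N}} := [set fiber z i | i : 'I_L] :\ finset.set0.

(** The nonempty fibers of [z] are the classes of its kernel relation, so the library's facts on
    [preim_partition] apply to them. *)
Lemma fibersE z : fibers z = preim_partition z [set: 'I_N].
Proof.
apply/setP => B; apply/setD1P/imsetP.
- move=> [/set0Pn[x xB] /imsetP[i _ BE]]; exists x => //.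
  move: xB; rewrite BE inE => /eqP <-.
  by apply/setP => y; rewrite !inE eq_sym.
- move=> [x _ ->]; split.
    by apply/set0Pn; exists x; rewrite !inE eqxx.
  by apply/imsetP; exists (z x) => //; apply/setP => y; rewrite !inE eq_sym.
Qed.

Lemma fibers_eqP z C : finset.partition C [set: 'I_N] ->
  reflect (forall x y, (z x == z y) = (finset.pblock C x == finset.pblock C y)) (fibers z == C).
Proof.
move=> pC; rewrite fibersE; apply: (iffP eqP) => [<- x y|zE].
- have pP := preim_partitionP z [set: 'I_N].
  have [_ tI _] := and3P pP.
  rewrite finset.eq_pblock//; last by rewrite (finset.cover_partition pP) inE.
  rewrite pblock_equivalence_partition ?inE//.
  by split => // /eqP ->.
- rewrite -[RHS](preim_partition_pblock pC).
  by apply: eq_imset => x; apply/setP => y; rewrite !inE zE.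
Qed.

(** A map with nonempty fibers [C] is constant on each block and separates distinct blocks, so it
    factors through a unique injection of the blocks into ['I_L]. *)
Lemma card_fibers_eq C : finset.partition C [set: 'I_N] ->
  #|[set z | fibers z == C]| = L ^_ #|C|.
Proof.
move=> pC; have [cC tC nC] := and3P pC.
have memC x : finset.pblock C x \in C by rewrite finset.pblock_mem// (eqP cC) inE.
(* Blocks are taken in a subtype, so that the injections to be counted are finite functions on a
   [finType]. *)
pose blk x : {B | B \in C} := exist _ (finset.pblock C x) (memC x).
have blk_surj (B : {B | B \in C}) : exists x, blk x == B.
  case: B => B BC; have /set0Pn[x xB] : B != finset.set0.
    by apply: contra nC => /eqP <-.
  by exists x; rewrite -val_eqE/= (finset.def_pblock tC BC xB).
pose lab (g : {ffun {B | B \in C} -> 'I_L}) : {ffun 'I_N -> 'I_L} :=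
  [ffun x => g (blk x)].
have lab_inj : injective lab.
  move=> g h /ffunP gh; apply/ffunP => B; have [x /eqP <-] := blk_surj B.
  by have := gh x; rewrite !ffunE.
rewrite -[L in RHS]card_ord -[#|C|]card_sig -card_inj_ffuns -(card_imset _ lab_inj).
apply: eq_card => z; rewrite [LHS]inE; apply/(fibers_eqP _ _ pC)/imsetP.
- move=> zE; pose rep B := xchoose (blk_surj B).
  have repK B : blk (rep B) = B by apply/eqP/(xchooseP (blk_surj B)).
  exists [ffun B => z (rep B)].
    rewrite inE; apply/injectiveP => B D; rewrite !ffunE => /eqP.
    by rewrite zE => /eqP bE; rewrite -(repK B) -(repK D); apply: val_inj.
  apply/ffunP => x; rewrite !ffunE; apply/eqP; rewrite zE.
  by have /(congr1 val)/= -> := repK (blk x).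
- move=> [g]; rewrite inE => /injectiveP g_inj -> x y.
  by rewrite !ffunE (inj_eq g_inj) -val_eqE.
Qed.

(** Once [z] fixes the parents, [f] splits into one injection of ['I_(n i)] into [fiber z i] for
    each [i]; these choices are independent because the fibers are disjoint. *)
Lemma card_injective_lifts (n : {ffun 'I_L -> 'I_N.+1}) z :
  #|[set f : {ffun {i : 'I_L & 'I_(n i)} -> 'I_N} |
      injectiveb f && [forall x, z (f x) == tag x]]| =
  (\prod_i #|fiber z i| ^_ (n i))%N.
Proof.
pose A i : {set {ffun 'I_(n i) -> 'I_N}} :=
  [set g in ffun_on (mem (fiber z i)) | injectiveb g].
pose glue (g : {dffun forall i, {ffun 'I_(n i) -> 'I_N}}) :
   {ffun {i : 'I_L & 'I_(n i)} -> 'I_N} := [ffun x => g (tag x) (tagged x)].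
have glue_inj : injective glue.
  move=> g h /ffunP gh; apply/ffunP => i; apply/ffunP => j.
  by have := gh (Tagged (fun i => 'I_(n i)) j); rewrite !ffunE.
transitivity #|setXn A|; last first.
  rewrite cardsXn; apply: eq_bigr => i _.
  by rewrite card_inj_ffuns_on card_ord.
rewrite -(card_imset _ glue_inj); apply: eq_card => f; rewrite inE.
apply/andP/imsetP.
- move=> [/injectiveP f_inj /forallP fz].
  exists [ffun i => [ffun j => f (Tagged (fun i => 'I_(n i)) j)]].
    apply/setXnP => i; rewrite !inE ffunE; apply/andP; split.
      by apply/ffun_onP => j; rewrite ffunE inE; apply: (fz (Tagged (fun i => 'I_(n i)) j)).
    apply/injectiveP => j j'; rewrite !ffunE => /f_inj /eqP.
    by rewrite eq_Tagged => /eqP.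
  by apply/ffunP => -[i j]; rewrite !ffunE.
- move=> [g /setXnP gA ->].
  have gz x : z (glue g x) = tag x.
    case: x => i j; rewrite ffunE /=.
    by have := gA i; rewrite !inE => /andP[/ffun_onP/(_ j)]; rewrite inE => /eqP.
  split; last by apply/forallP => x; rewrite gz.
  apply/injectiveP => -[i j] [i' j'] e.
  (* Equal images lie in the same fiber, which forces equal tags; only then do [j] and [j'] have the
     same type. *)
  have ii : i = i' by rewrite -[i]/(tag (Tagged (fun i => 'I_(n i)) j)) -gz e gz.
  case: i' / ii j' e => j'; rewrite !ffunE /=.
  by have := gA i; rewrite !inE => /andP[_ /injectiveP g_inj] /g_inj ->.
Qed.


Lemma sum_card_fiber z : (\sum_i #|fiber z i| = N)%N.
Proof.
rewrite -[RHS]card_ord -sum1_card (partition_big z xpredT)//=.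
by apply: eq_bigr => i _; rewrite -sum1_card; apply: eq_bigl => x; rewrite inE.
Qed.

Lemma card_pts (n : {ffun 'I_L -> 'I_N.+1}) :
  #|pts n| = (\sum_(i < L) n i)%N.
Proof.
rewrite card_tagged sumnE big_map big_enum/=.
by apply: eq_bigr => i _; rewrite card_ord.
Qed.

(** Double counting of the pairs [(f, z)] with [f] compatible with [z]. As there are exactly [N]
    points, an injective [f] is a bijection, hence compatible with a single parent map, the tag of
    its inverse. *)
Lemma card_induced (n : {ffun 'I_L -> 'I_N.+1}) C :
  (\sum_(i < L) n i)%N = N ->
  #|[set f : {ffun pts n -> 'I_N} | injectiveb f && (Defs.induced f == C)]| =
  (\sum_(z : {ffun 'I_N -> 'I_L} | fibers z == C)
     \prod_(i < L) #|fiber z i| ^_ (n i))%N.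
Proof.
move=> sumn; under [RHS]eq_bigr do rewrite -card_injective_lifts -sum1dep_card.
rewrite (exchange_big_dep (fun f : {ffun pts n -> 'I_N} => injectiveb f)) /=;
  last by move=> z f _ /andP[].
rewrite -sum1dep_card big_mkcondr /=; apply: eq_bigr => f f_injb.
have [|g fK gK] := inj_card_bij (elimT (injectiveP f) f_injb).
  by rewrite card_pts sumn card_ord.
pose z0 : {ffun 'I_N -> 'I_L} := [ffun x => tag (g x)].
have liftE z : [forall x, z (f x) == tag x] = (z == z0).
  apply/forallP/eqP => [zf|-> x]; last by rewrite ffunE fK.
  by apply/ffunP => x; rewrite ffunE -(eqP (zf (g x))) gK.
have z0E : fibers z0 = Defs.induced f.
  congr (_ :\ _); apply: eq_imset => i; apply/setP => x; rewrite inE ffunE.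
  rewrite -[in RHS](gK x) mem_imset; last exact: can_inj fK.
  by rewrite mem_mkset_bool.
under eq_bigl do rewrite f_injb liftE andTb.
rewrite -z0E; case: ifPn => [Cz0|Cz0].
  rewrite (bigD1 z0) ?Cz0 ?eqxx//= big1 ?addn0// => z.
  by rewrite -andbA => /and3P[_ ->].
by rewrite big_pred0// => z; apply/andP => -[+ /eqP zz0]; rewrite zz0 (negPf Cz0).
Qed.

(** After the two sums are exchanged, each [z] keeps a single term, the one where [n] lists its
    fiber sizes; the falling factorials there are full factorials. The summand left depends on [C]
    only. *)
Lemma sum_weighted_labelings (F : numFieldType) (h : nat -> F) C :
  h 0%N = 1 -> finset.partition C [set: 'I_N] ->
  \sum_(n : {ffun 'I_L -> 'I_N.+1} | (\sum_(i < L) (n i : nat))%N == N)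
    (\prod_(i < L) (h (n i) / (n i)`!%:R) *
     #|[set f : {ffun pts n -> 'I_N} |
         injectiveb f && (Defs.induced f == C)]|%:R) =
  (L ^_ #|C|)%:R * \prod_(B in C) h #|B|.
Proof.
move=> h0 pC.
transitivity (\sum_(n : {ffun 'I_L -> 'I_N.+1} | (\sum_(i < L) (n i : nat))%N == N)
    \sum_(z : {ffun 'I_N -> 'I_L} | fibers z == C)
      (\prod_(i < L) (h (n i) / (n i)`!%:R)) *
      (\prod_(i < L) #|fiber z i| ^_ (n i))%:R).
  apply: eq_bigr => n /eqP sumn; rewrite -mulr_sumr -natr_sum -card_induced//.
rewrite exchange_big /= -(card_fibers_eq _ pC) -sumr_const mulr_suml.
rewrite [RHS](eq_bigl (fun z => fibers z == C)); last by move=> z; rewrite inE.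
apply: eq_bigr => z /eqP zC; rewrite mul1r.
pose n0 : {ffun 'I_L -> 'I_N.+1} := [ffun i => inord #|fiber z i|].
have n0E i : n0 i = #|fiber z i| :> nat.
  by rewrite ffunE inordK// ltnS -[X in (_ <= X)%N]card_ord max_card.
rewrite (bigD1 n0) /=; last by under eq_bigr do rewrite n0E; rewrite sum_card_fiber.
rewrite [X in _ + X]big1 ?addr0; last first.
  (* Both [n] and the fiber sizes sum to [N], so if they differ then [n] exceeds some fiber size,
     and that falling factorial vanishes. *)
  move=> n /andP[/eqP sumn nn0].
  suff [i lti] : exists i, (#|fiber z i| < n i)%N.
    by rewrite natr_prod [X in _ * X](bigD1 i)//= ffact_small// mul0r mulr0.
  apply/existsP; apply: contraNT nn0; rewrite negb_exists => /forallP le_n.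
  have n_le i : xpredT i ->
      (n i <= #|fiber z i| ?= iff (n i == #|fiber z i| :> nat))%N.
    by move=> _; apply: leqif_eq; rewrite leqNgt le_n.
  have [_] := leqif_sum n_le; rewrite sumn sum_card_fiber eqxx => /esym/forallP nE.
  by apply/eqP/ffunP => i; apply: ord_inj; rewrite n0E; exact/eqP/nE.
rewrite natr_prod -big_split /=.
under eq_bigr => i _ do
  rewrite n0E ffactnn divfK ?pnatr_eq0 -?lt0n ?fact_gt0//.
(* Latent events without offspring have weight [h 0 = 1]; the others correspond one to one to the
   blocks. *)
rewrite (bigID (fun i => fiber z i == finset.set0)) /= big1 ?mul1r; last first.
  by move=> i /eqP ->; rewrite cards0.
have fiber_inj : {in [set i | fiber z i != finset.set0] &, injective (fiber z)}.
  move=> i j; rewrite inE => /set0Pn[x xi] _ eij.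
  by move: (xi); rewrite eij; move: xi; rewrite !inE => /eqP -> /eqP.
rewrite -zC (_ : fibers z = fiber z @: [set i | fiber z i != finset.set0]).
  by rewrite big_imset//=; apply: eq_bigl => i; rewrite inE.
apply/setP => B; apply/setD1P/imsetP => [[B0 /imsetP[i _ BE]]|[i]].
  by exists i => //; rewrite inE -BE.
by rewrite inE => i0 ->; split => //; apply/imsetP; exists i.
Qed.

End labelings.
Local Open Scope classical_set_scope.
Local Open Scope ring_scope.

(** * Dilation of the half-line under Lebesgue measure *)

Section dilation.
Context {R : realType}.
Local Notation mu := (@lebesgue_measure R).
Local Open Scope ereal_scope.

(** By uniqueness of Lebesgue measure: [c] times its pushforward under multiplication by [c] gives
    each interval its length. *)
Lemma ge0_integral_dilation (c : R) (f : R -> \bar R) : (0 < c)%R ->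
  measurable_fun setT f -> (forall x, 0 <= f x) ->
  \int[mu]_(x in `]0%R, +oo[) f x =
  c%:E * \int[mu]_(x in `]0%R, +oo[) f (c * x)%R.
Proof.
move=> c0 mf f0; pose phi : measurableTypeR R -> measurableTypeR R := *%R c.
have mphi : measurable_fun setT phi by exact: mulrl_measurable.
(* [m] is the pushforward bundled with its measure structure, which depends on the proof [mphi]. *)
have [m mE] : exists m : {measure set (measurableTypeR R) -> \bar R},
    m = pushforward mu phi :> (set (measurableTypeR R) -> \bar R).
  by unshelve eexists; first (by refine (pushforward mu phi); exact: mphi).
pose c' : {nonneg R} := NngNum (ltW c0).
have muE A : measurable A -> mu A = mscale c' m A.
  apply: lebesgue_measure_unique => //= _ [[a b]] _ <-.
  rewrite /mscale/= mE /pushforward.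
  have -> : phi @^-1` `]a, b] = `](a / c)%R, (b / c)%R]%classic.
    apply/seteqP; split => x /=;
      by rewrite !in_itv/= ltr_pdivrMr// ler_pdivlMr// mulrC.
  rewrite !lebesgue_measure_itv/= !lte_fin ltr_pM2r ?invr_gt0//.
  case: ifPn => _; last by rewrite mule0.
  by rewrite -!EFinB -EFinM -mulrBl mulrC divfK// gt_eqF.
rewrite (eq_measure_integral (mscale c' m)); last by move=> A mA _; exact: muE.
have mf0 : measurable_fun (`]0%R, +oo[%classic : set R) f by exact: measurable_funTS.
rewrite ge0_integral_mscale//; congr (_ * _).
rewrite (eq_measure_integral (pushforward mu phi)); last by move=> A _ _; rewrite mE.
rewrite ge0_integral_pushforward//.
congr integral.
by apply/seteqP; split => x /=; rewrite /phi !in_itv/= !andbT pmulr_rgt0.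
Qed.
End dilation.

(** * Finiteness, positivity and rescaling of the Gamma integral *)

Section gamma_integral.
Context {R : realType}.
Local Notation mu := (@lebesgue_measure R).

Lemma is_derive_powR1D (a x : R) : 0 < x ->
  is_derive x 1 (fun t => (1 + t) `^ a) (a * (1 + x) `^ (a - 1)).
Proof.
move=> x0.
have d1 : is_derive (1 + x) 1 (@powR R ^~ a) (a * (1 + x) `^ (a - 1)).
  by apply: is_derive1_powR; rewrite addr_gt0.
have d2 : is_derive x 1 (fun t : R => 1 + t) (0 + 1) by exact: is_deriveD.
have := @is_derive1_comp _ _ _ _ _ _ d1 d2.
by rewrite add0r mulr1.
Qed.

Lemma powR_recl (x r : R) : 0 < x -> x `^ r = x * x `^ (r - 1).
Proof.
move=> x0; rewrite -{2}(powRr1 (ltW x0)) -powRD ?(gt_eqF x0) ?implybT//.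
by rewrite addrC subrK.
Qed.

(* [t^(s-1) (1+t)^(-s-1)] majorizes the Gamma integrand up to a constant and, unlike
   it, has an elementary primitive, bounded by [1/s]. *)
Lemma is_derive_betaprime (s x : R) : s != 0 -> 0 < x ->
  is_derive x 1 (fun t => s^-1 * (t `^ s * (1 + t) `^ (- s)))
    (x `^ (s - 1) * (1 + x) `^ (- s - 1)).
Proof.
move=> s0 x0.
have d1 : is_derive x 1 (@powR R ^~ s) (s * x `^ (s - 1)) by exact: is_derive1_powR.
have d2 := is_derive_powR1D (- s) x x0.
have d3 : is_derive x 1 (fun t => s^-1 * (t `^ s * (1 + t) `^ (- s))) _ :=
  is_deriveZ s^-1 (is_deriveM d1 d2).
apply: is_derive_eq.
rewrite /GRing.scale/=.
rewrite (powR_recl _ s x0) (powR_recl _ (- s) (addr_gt0 ltr01 x0)).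
by field.
Qed.

(** Multiplying out, the claim is that [(1 + t) ^ r] is at most [(m+1)! * exp (1 + t)]. It follows
    from one term of the exponential series, as [m + 1 > |r|] and [1 + t >= 1]; the factor [expR 1]
    pays for the shift from [t] to [1 + t]. *)
Lemma expRN_le_powR (r : R) : exists2 c : R, 0 <= c &
  forall t, 0 < t -> expR (- t) <= c * (1 + t) `^ (- r).
Proof.
pose m := Num.truncn `|r|; exists (m.+1`!%:R * expR 1) => [|t t0].
  by rewrite mulr_ge0// expR_ge0.
have t1 : 0 < 1 + t by rewrite addr_gt0.
rewrite powRN expRN -[_^-1]mul1r ler_pdivlMr ?powR_gt0// mulrC mul1r.
rewrite ler_pdivrMr ?expR_gt0// -mulrA -expRD.
have rm : (1 + t) `^ r <= (1 + t) ^+ m.+1.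
  rewrite -powR_mulrn ?(ltW t1)//; apply: ler_powR; first by rewrite lerDl ltW.
  by rewrite (le_trans (ler_norm _))// ltW// truncnS_gt.
rewrite (le_trans rm)// mulrC -ler_pdivrMr ?ltr0n ?fact_gt0//.
by apply: le_trans (expR_ge1Dxn m (ltW t1)); rewrite lerDr.
Qed.

Lemma betaprime_integral_le (s a b : R) : 0 < s -> 0 < a -> a < b ->
  (\int[mu]_(t in `[a, b]) (t `^ (s - 1) * (1 + t) `^ (- s - 1))%:E <=
   (s^-1)%:E)%E.
Proof.
move=> s0 a0 ab; have b0 := lt_trans a0 ab.
pose F (t : R) := s^-1 * (t `^ s * (1 + t) `^ (- s)).
have dF (t : R) : 0 < t -> is_derive t 1 F (t `^ (s - 1) * (1 + t) `^ (- s - 1)).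
  by move=> t0; apply: is_derive_betaprime => //; rewrite gt_eqF.
have cF (t : R) : 0 < t -> {for t, continuous F}.
  move=> t0; apply: differentiable_continuous; apply/derivable1_diffP.
  by have [] := dF _ t0.
have F0 (t : R) : 0 <= F t by rewrite !mulr_ge0 ?powR_ge0// invr_ge0 ltW.
rewrite (continuous_FTC2 ab (F := F)).
(* [F a] is nonnegative and is dropped; [F b] is at most [1 / s] because [b ^ s <= (1 + b) ^ s]. *)
- rewrite -EFinB lee_fin lerBlDr ler_wpDr//.
  rewrite ger_pMr ?invr_gt0// powRN ler_pdivrMr ?powR_gt0 ?addr_gt0// mul1r.
  by rewrite ge0_ler_powR ?nnegrE ?ltW ?addr_gt0// ltrDr.
- apply: derivable_within_continuous => t; rewrite in_itv/= => /andP[at_ _].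
  have t0 := lt_le_trans a0 at_.
  have d1 := is_derive1_powR (s - 1) t0.
  have d2 := is_derive_powR1D (- s - 1) t t0.
  by have [] := is_deriveM d1 d2.
- split.
  + move=> t; rewrite in_itv/= => /andP[at_ _].
    by have [] := dF t (lt_trans a0 at_).
  + exact/cvg_at_right_filter/cF.
  + exact/cvg_at_left_filter/cF.
- move=> t; rewrite in_itv/= => /andP[at_ _].
  by have [_ <-] := dF t (lt_trans a0 at_); rewrite derive1E.
Qed.

Lemma measurable_gamma_integrand (s : R) :
  measurable_fun setT (fun t : R => (t `^ (s - 1) * expR (- t))%:E).
Proof.
apply/measurable_EFinP; apply: measurable_funM; first exact: measurable_powR.
exact: measurableT_comp.
Qed.

(** The half-line is exhausted by compact intervals away from the possible singularity at 0; on each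
    of them the majorant gives the same bound [c / s], which passes to the limit by monotone
    convergence. *)
Lemma gamma_integral_lty (s : R) : 0 < s ->
  (\int[mu]_(t in `]0%R, +oo[) (t `^ (s - 1) * expR (- t))%:E < +oo)%E.
Proof.
move=> s0; have [c c0 cP] := expRN_le_powR (s + 1).
(* The shift by 2 keeps the endpoints distinct already at [n = 0], where the interval is
   [[1/2, 2]]. *)
pose D n := [set` `[n.+2%:R^-1 : R, n.+2%:R : R]].
have DP n t : D n t = (n.+2%:R^-1 <= t <= n.+2%:R) by rewrite /D/= in_itv.
have DE : \bigcup_n D n = `]0, +oo[%classic.
  apply/seteqP; split => [t [n _]|t] /=; rewrite ?DP in_itv/= andbT.
    by move=> /andP[nt _]; apply: lt_le_trans nt; rewrite invr_gt0.
  (* An integer above [t + 1/t] exceeds both [t] and [1/t]. *)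
  move=> t0; exists (Num.truncn (t + t^-1)) => //; rewrite DP.
  have : t + t^-1 < (Num.truncn (t + t^-1)).+2%:R.
    by rewrite (lt_trans (truncnS_gt _))// ltr_nat.
  move: (Num.truncn _).+2 => n tn.
  have tV : 0 < t^-1 by rewrite invr_gt0.
  have n0 : 0 < n%:R :> R by rewrite (lt_trans _ tn)// addr_gt0.
  apply/andP; split; last by rewrite (le_trans _ (ltW tn))// lerDl ltW.
  rewrite -[leRHS]invrK lef_pV2 ?posrE//.
  by rewrite (le_trans _ (ltW tn))// lerDr ltW.
have ndD : nondecreasing_seq D.
  move=> m n mn; apply/subsetPset => t; rewrite !DP => /andP[mt tm].
  apply/andP; split; last by rewrite (le_trans tm)// ler_nat !ltnS.
  by rewrite (le_trans _ mt)// lef_pV2 ?posrE// ler_nat !ltnS.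
have f0 (t : R) : (0 <= (t `^ (s - 1) * expR (- t))%:E)%E.
  by rewrite lee_fin mulr_ge0 ?powR_ge0 ?expR_ge0.
have mf n : measurable_fun (D n) (fun t : R => (t `^ (s - 1) * expR (- t))%:E).
  by apply: measurable_funTS; exact: measurable_gamma_integrand.
have D_gt0 n t : D n t -> 0 < t.
  by rewrite DP => /andP[nt _]; apply: lt_le_trans nt; rewrite invr_gt0.
apply: (@le_lt_trans _ _ (c * s^-1)%:E); last exact: ltry.
rewrite -DE.
have cvgD : (\int[mu]_(t in D n) (t `^ (s - 1) * expR (- t))%:E @[n --> \oo] -->
    \int[mu]_(t in \bigcup_n D n) (t `^ (s - 1) * expR (- t))%:E)%E.
  by apply: ge0_nondecreasing_set_cvg_integral => // n; exact: measurable_itv.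
rewrite -(cvg_lim _ cvgD)//; apply: lime_le; first by apply/cvg_ex; eexists; exact: cvgD.
apply: nearW => n.
have mg : measurable_fun (D n) (fun t : R => (t `^ (s - 1) * (1 + t) `^ (- s - 1))%:E).
  apply/measurable_EFinP/measurable_funTS; apply: measurable_funM => //.
  by apply: (measurableT_comp (measurable_powR _)); exact: measurable_funD.
have g0 t : D n t -> (0 <= (t `^ (s - 1) * (1 + t) `^ (- s - 1))%:E)%E.
  by rewrite lee_fin mulr_ge0 ?powR_ge0.
apply: (@le_trans _ _ (\int[mu]_(t in D n)
    (c%:E * (t `^ (s - 1) * (1 + t) `^ (- s - 1))%:E))%E).
  apply: ge0_le_integral => //=.
  - exact: measurable_itv.
  - exact: mf.
  - exact: measurable_funeM.
  - move=> t /D_gt0 t0; rewrite lee_fin mulrCA ler_wpM2l ?powR_ge0//.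
    by rewrite (le_trans (cP t t0))// opprD.
rewrite ge0_integralZl//; last exact: measurable_itv.
rewrite EFinM lee_wpmul2l ?lee_fin//.
apply: betaprime_integral_le => //; rewrite ?invr_gt0//.
by rewrite (@lt_trans _ _ 1)// ?invf_lt1 ?ltr1n.
Qed.

(** [Gamma] is defined through [fine], which would turn an infinite integral into 0; finiteness
    makes it the true value. *)
Lemma gamma_integralE (s : R) : 0 < s ->
  (\int[mu]_(t in `]0%R, +oo[) (t `^ (s - 1) * expR (- t))%:E = (Gamma s)%:E)%E.
Proof.
move=> s0; rewrite /Gamma fineK// ge0_fin_numE ?gamma_integral_lty//.
by apply: integral_ge0 => t _; rewrite lee_fin mulr_ge0 ?powR_ge0 ?expR_ge0.
Qed.

Lemma Gamma_gt0 (s : R) : 0 < s -> 0 < Gamma s.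
Proof.
move=> s0; rewrite -lte_fin -gamma_integralE//.
have f0 (t : R) : (0 <= (t `^ (s - 1) * expR (- t))%:E)%E.
  by rewrite lee_fin mulr_ge0 ?powR_ge0 ?expR_ge0.
have mf (D : set R) : measurable_fun D (fun t : R => (t `^ (s - 1) * expR (- t))%:E).
  by apply: measurable_funTS; exact: measurable_gamma_integrand.
(* On [[1, 2]], [s > 0] gives [t ^ (s - 1) >= 1/t >= 1/2], and [exp (- t) >= exp (- 2)]. *)
apply: (@lt_le_trans _ _ (\int[mu]_(t in `[1%R, 2%R]) (2^-1 * expR (- 2))%:E)%E).
  rewrite integral_cst//= lebesgue_measure_itv/= lte_fin ltr1n/=.
  by rewrite -EFinB -EFinM lte_fin !mulr_gt0 ?expR_gt0// subr_gt0 ltr1n.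
apply: (@le_trans _ _ (\int[mu]_(t in `[1%R, 2%R]) (t `^ (s - 1) * expR (- t))%:E)%E).
  apply: ge0_le_integral => //=.
  - exact: mf.
  - move=> t; rewrite in_itv/= => /andP[t1 t2]; rewrite lee_fin.
    have t0 : 0 < t by exact: lt_le_trans t1.
    rewrite ler_pM ?expR_ge0 ?invr_ge0 ?ler_expR ?lerN2//.
    apply: (@le_trans _ _ t^-1); first by rewrite lef_pV2 ?posrE.
    by rewrite -(powR_inv1 (ltW t0)) ler_powR// lerBrDr addNr ltW.
apply: ge0_subset_integral => //=; first exact: mf.
by move=> t /=; rewrite !in_itv/= andbT => /andP[t1 _]; exact: lt_le_trans t1.
Qed.

(** Substituting [c * t] in the Gamma integral yields [c ^ (s - 1)] from the integrand and [c] from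
    the measure. *)
Lemma gamma_integral_rate (s c : R) : 0 < s -> 0 < c ->
  (\int[mu]_(t in `]0%R, +oo[) (t `^ (s - 1) * expR (- (c * t)))%:E =
   (Gamma s / c `^ s)%:E)%E.
Proof.
move=> s0 c0.
have mf := measurable_gamma_integrand s.
have f0 (t : R) : (0 <= (t `^ (s - 1) * expR (- t))%:E)%E.
  by rewrite lee_fin mulr_ge0 ?powR_ge0 ?expR_ge0.
have := ge0_integral_dilation c _ c0 mf f0; rewrite gamma_integralE// => GE.
have : ((Gamma s)%:E = (c `^ s)%:E * \int[mu]_(t in `]0%R, +oo[)
    (t `^ (s - 1) * expR (- (c * t)))%:E)%E.
  rewrite GE (powR_recl _ s c0) EFinM -muleA; congr (_ * _)%E.
  rewrite -ge0_integralZl//.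
  - apply: eq_integral => t; rewrite inE/= in_itv/= andbT => t0.
    by rewrite -EFinM powRM ?ltW// mulrA.
  - apply/measurable_EFinP/measurable_funTS; apply: measurable_funM => //.
    apply: measurableT_comp => //; apply: measurableT_comp => //.
  - by move=> t _; rewrite lee_fin mulr_ge0 ?powR_ge0 ?expR_ge0.
  - by rewrite lee_fin powR_ge0.
rewrite mulrC EFinM => ->.
by rewrite muleA -EFinM mulVf ?mul1e// gt_eqF// powR_gt0.
Qed.
End gamma_integral.

(** * Integration over weights, locations and parameters of the latent events *)

Section latent.
Context {R : realType} {dT dS : measure_display}.
Context {T : measurableType dT} {S : measurableType dS}.
Variables (mu : {measure set T -> \bar R}) (nu : {measure set S -> \bar R}).
Variables (p : T -> R) (k : T -> S -> R) (alpha beta : R).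
Hypothesis p_ge0 : forall t, 0 <= p t.
Hypothesis p_meas : measurable_fun setT p.
Hypothesis p_int1 : (\int[mu]_t (p t)%:E = 1)%E.
Hypothesis k_int1 : forall t, (\int[nu]_s (k t s)%:E = 1)%E.
Hypotheses (alpha_gt0 : 0 < alpha) (beta_gt0 : 0 < beta).

Lemma gamma_pdf_ge0 w : 0 <= gamma_pdf alpha beta w.
Proof.
by rewrite /gamma_pdf !mulr_ge0 ?powR_ge0 ?expR_ge0// invr_ge0 ltW// Gamma_gt0.
Qed.

Lemma measurable_gamma_pdf : measurable_fun setT (gamma_pdf alpha beta).
Proof.
apply: measurable_funM; last first.
  by apply: measurableT_comp => //; apply: measurableT_comp => //; exact: mulrl_measurable.
by apply: measurable_funM => //; exact: measurable_powR.
Qed.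

Section product_integrands.
Variables (G : nat -> R -> R) (M : nat -> R).
Hypothesis G_meas : forall n, measurable_fun setT (G n).
Hypothesis G_ge0 : forall n w, 0 < w -> 0 <= G n w.
Hypothesis G_int : forall n,
  (\int[lebesgue_measure]_(w in `]0%R, +oo[) (gamma_pdf alpha beta w * G n w)%:E =
   (M n)%:E)%E.

Let M_ge0 n : 0 <= M n.
Proof.
rewrite -lee_fin -G_int; apply: integral_ge0 => w; rewrite /= in_itv/= andbT => w0.
by rewrite lee_fin mulr_ge0 ?gamma_pdf_ge0 ?G_ge0.
Qed.

(** Induction on [L], stated for arbitrary nonnegative coefficients: once the first weight is fixed,
    its factor is absorbed into [c] and the rest has the same form. Nonnegativity allows the sum and
    the integral to be exchanged. [e] is indexed by [nat], so dropping the first event is a plain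
    shift. *)
Lemma latent_int_sum_prod (J : finType) L (e : J -> nat -> nat) (c : J -> R) :
  (forall j, 0 <= c j) ->
  latent_int mu nu p k alpha beta L
    (fun s => (\sum_j c j * \prod_(i < L) G (e j i) s`_i)%:E) =
  (\sum_j c j * \prod_(i < L) M (e j i))%:E.
Proof.
elim: L e c => [|L IH] e c c0 /=.
  by congr _%:E; apply: eq_bigr => j _; rewrite !big_ord0.
pose A j := c j * \prod_(i < L) M (e j i.+1).
have A0 j : 0 <= A j by rewrite mulr_ge0// prodr_ge0.
transitivity (\int[lebesgue_measure]_(w in `]0%R, +oo[)
    \sum_j ((A j)%:E * (gamma_pdf alpha beta w * G (e j 0%N) w)%:E))%E.
  apply: eq_integral => w; rewrite inE/= in_itv/= andbT => w0.
  pose B := \sum_j c j * G (e j 0%N) w * \prod_(i < L) M (e j i.+1).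
  have B0 : 0 <= B.
    by apply: sumr_ge0 => j _; rewrite !mulr_ge0 ?prodr_ge0 ?G_ge0.
  transitivity (\int[mu]_t ((gamma_pdf alpha beta w * B)%:E * (p t)%:E))%E.
    apply: eq_integral => t _.
    rewrite -[RHS]EFinM [in RHS]mulrAC [RHS]EFinM; congr (_ * _)%E.
    have cG0 j : 0 <= c j * G (e j 0%N) w by rewrite mulr_ge0// G_ge0.
    rewrite -[RHS](IH (fun j i => e j i.+1) _ cG0).
    congr latent_int; apply/funext => s; congr _%:E; apply: eq_bigr => j _.
    (* The unit mass of the impulse response removes the dependence on [t]. *)
    by rewrite big_ord_recl /= mulrA /mass k_int1 mulr1.
  rewrite ge0_integralZl//; last 3 first.
  - exact/measurable_EFinP.
  - by move=> t _; rewrite lee_fin.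
  - by rewrite lee_fin mulr_ge0// gamma_pdf_ge0.
  rewrite p_int1 mule1 mulr_sumr -sumEFin; apply: eq_bigr => j _.
  by rewrite -EFinM /A; congr _%:E; ring.
have mG j : measurable_fun (`]0%R, +oo[%classic : set R)
    (fun w => (gamma_pdf alpha beta w * G (e j 0%N) w)%:E).
  apply/measurable_EFinP/measurable_funTS; apply: measurable_funM => //.
  exact: measurable_gamma_pdf.
have G0 j w : `]0%R, +oo[%classic w ->
    (0 <= (gamma_pdf alpha beta w * G (e j 0%N) w)%:E)%E.
  rewrite /= in_itv/= andbT => w0.
  by rewrite lee_fin mulr_ge0 ?gamma_pdf_ge0 ?G_ge0.
rewrite ge0_integral_sum//; last 2 first.
- by move=> j; exact: (measurable_funeM _ (mG j)).
- by move=> j w w0; rewrite mule_ge0 ?lee_fin// -lee_fin G0.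
rewrite -sumEFin; apply: eq_bigr => j _.
rewrite ge0_integralZl ?lee_fin//; [|exact: mG|exact: G0].
by rewrite G_int -EFinM big_ord_recl /A; congr _%:E; rewrite /=; ring.
Qed.

End product_integrands.

(** Gamma-Poisson conjugacy: the integrand is a constant times the unnormalised gamma density of
    shape [n + alpha] and rate [1 + beta]. *)
Lemma integral_gamma_pdf_Po n :
  (\int[lebesgue_measure]_(w in `]0%R, +oo[) (gamma_pdf alpha beta w * Po w n)%:E =
   ((beta / (1 + beta)) `^ alpha * (1 / (1 + beta)) ^+ n *
    (Gamma (n%:R + alpha) / Gamma alpha / n`!%:R))%:E)%E.
Proof.
have b1 : 0 < 1 + beta by rewrite addr_gt0.
have na : 0 < n%:R + alpha by rewrite ltr_wpDl.
transitivity (\int[lebesgue_measure]_(w in `]0%R, +oo[)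
  ((beta `^ alpha / Gamma alpha / n`!%:R)%:E *
   (w `^ (n%:R + alpha - 1) * expR (- ((1 + beta) * w)))%:E))%E.
  apply: eq_integral => w; rewrite inE/= in_itv/= andbT => w0.
  rewrite -EFinM; congr _%:E; rewrite /gamma_pdf /Po.
  have -> : w `^ (n%:R + alpha - 1) = w ^+ n * w `^ (alpha - 1).
    by rewrite -(powR_mulrn n (ltW w0)) -powRD ?(gt_eqF w0) ?implybT// addrA.
  by rewrite mulrDl mul1r opprD expRD; ring.
rewrite ge0_integralZl//; last 3 first.
- apply/measurable_EFinP/measurable_funTS; apply: measurable_funM => //.
  by apply: measurableT_comp => //; apply: measurableT_comp => //; exact: mulrl_measurable.
- by move=> t _; rewrite lee_fin mulr_ge0 ?powR_ge0 ?expR_ge0.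
- by rewrite lee_fin !mulr_ge0 ?powR_ge0 ?invr_ge0// ltW// Gamma_gt0.
rewrite gamma_integral_rate// -EFinM; congr _%:E.
rewrite powRD ?(gt_eqF b1) ?implybT// powR_mulrn ?(ltW b1)//.
rewrite powRM ?invr_ge0 ?ltW// -[(1 + beta)^-1](powR_inv1 (ltW b1)) -powRrM mulN1r powRN.
rewrite mul1r powR_inv1 ?(ltW b1)// exprVn.
by field; rewrite !gt_eqF ?exprn_gt0 ?powR_gt0 ?Gamma_gt0.
Qed.


Lemma latent_int_obs_prob L N (C : {set {set 'I_N}}) :
  finset.partition C [set: 'I_N] ->
  latent_int mu nu p k alpha beta L (fun a => (obs_prob L C a)%:E) =
  (N`!%:R^-1 * (1 / (1 + beta)) ^+ N *
   ((L ^_ #|C|)%:R * (beta / (1 + beta)) `^ (L%:R * alpha)) *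
   \prod_(B in C) (Gamma (#|B|%:R + alpha) / Gamma alpha))%:E.
Proof.
move=> pC.
pose h n := Gamma (n%:R + alpha) / Gamma alpha.
have h0 : h 0%N = 1 by rewrite /h add0r divff// gt_eqF// Gamma_gt0.
pose lab (n : {ffun 'I_L -> 'I_N.+1}) :=
  finset (fun f : {ffun pts n -> 'I_N} => injectiveb f && (Defs.induced f == C)).
(* The constraint on the total count moves into the coefficient, so that the sum ranges over a whole
   [finType]. *)
pose c (n : {ffun 'I_L -> 'I_N.+1}) : R :=
  if (\sum_(i < L) (n i : nat))%N == N then #|lab n|%:R / N`!%:R else 0.
have c0 n : 0 <= c n by rewrite /c; case: ifP => // _; rewrite divr_ge0.
(* [n] is extended by 0 beyond [L], values that the product over [i < L] never reads. *)
pose e (n : {ffun 'I_L -> 'I_N.+1}) (i : nat) : nat :=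
  oapp (fun j : 'I_L => n j : nat) 0%N (insub i).
have eE n (i : 'I_L) : e n i = n i by rewrite /e valK.
transitivity (latent_int mu nu p k alpha beta L
    (fun s => (\sum_n c n * \prod_(i < L) Po s`_i (e n i))%:E)).
  congr latent_int; apply/funext => s; congr _%:E.
  rewrite /obs_prob big_mkcond; apply: eq_bigr => n _; rewrite /c.
  case: ifP => _; last by rewrite mul0r.
  rewrite mulrC; congr (_%:R / _ * _).
    by apply: eq_card => f; rewrite mem_mkset_bool inE.
  by apply: eq_bigr => i _; rewrite eE.
rewrite (latent_int_sum_prod _ _ _ _ integral_gamma_pdf_Po)//; last 2 first.
- move=> n; rewrite /Po.
  apply: measurable_funM => //; apply: measurable_funM => //.
  exact: measurableT_comp.
- by move=> n w w0; rewrite /Po !mulr_ge0 ?expR_ge0 ?exprn_ge0 ?ltW.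
congr _%:E.
set q := beta / (1 + beta); set r := 1 / (1 + beta).
have q0 : 0 <= q by rewrite divr_ge0 ?addr_ge0 ?ltW.
transitivity (\sum_(n : {ffun 'I_L -> 'I_N.+1} | (\sum_(i < L) (n i : nat))%N == N)
    (N`!%:R^-1 * r ^+ N * q `^ (L%:R * alpha)) *
    (\prod_(i < L) (h (n i) / (n i)`!%:R) * #|lab n|%:R)).
  rewrite [RHS]big_mkcond; apply: eq_bigr => n _; rewrite /c.
  case: ifPn => [/eqP sumn|_]; last by rewrite mul0r.
  have -> : \prod_(i < L) (q `^ alpha * r ^+ e n i *
      (Gamma ((e n i)%:R + alpha) / Gamma alpha / (e n i)`!%:R)) =
      q `^ (L%:R * alpha) * r ^+ N * \prod_(i < L) (h (n i) / (n i)`!%:R).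
    under eq_bigr do rewrite eE.
    rewrite !big_split /= prodr_const card_ord prodrXr sumn.
    by rewrite (mulrC L%:R) powRrM powR_mulrn ?powR_ge0.
  by ring.
rewrite -mulr_sumr sum_weighted_labelings//.
by rewrite -!mulrA; congr (_ * (_ * _)); rewrite mulrCA.
Qed.

End latent.

(** * Summation over the number of latent events *)

Theorem theorem1 (R : realType) (dT dS : measure_display)
  (T : measurableType dT) (S : measurableType dS)
  (mu : {measure set T -> \bar R}) (nu : {measure set S -> \bar R})
  (p : T -> R) (k : T -> S -> R) (Lbar alpha beta : R)
  (hp0 : forall t, 0 <= p t) (hpm : measurable_fun setT p)
  (hp1 : (\int[mu]_t (p t)%:E = 1)%E)
  (hk0 : forall t s, 0 <= k t s)
  (hkm : measurable_fun setT (fun ts : T * S => k ts.1 ts.2))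
  (hk1 : forall t, (\int[nu]_s (k t s)%:E = 1)%E)
  (hL : 0 < Lbar) (ha : 0 < alpha) (hb : 0 < beta)
  (N : nat) (C : {set {set 'I_N}}) (hC : finset.partition C [set: 'I_N]) :
  pNC mu nu p k Lbar alpha beta C =
  (V_coef Lbar alpha beta N #|C| *
   (\prod_(B in C) (Gamma (#|B|%:R + alpha) / Gamma alpha))%:E)%E.
Proof.
rewrite /pNC /V_coef muleAC -EFinM [in RHS]eseries_cond [in RHS]eseries_mkcondr -nneseriesZl.
  apply: eq_eseriesr => L _; rewrite latent_int_obs_prob//.
  (* The series defining [pNC] starts at [L = 0]; its terms with [L < |C|] vanish with the falling
     factorial, matching the truncated series. *)
  case: leqP => [KL|LK]; last by rewrite ffact_small// mul0r mulr0 mul0r !mule0.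
  have fK : (L - #|C|)`!%:R != 0 :> R by rewrite pnatr_eq0 -lt0n fact_gt0.
  rewrite -!EFinM -(ffact_fact KL) natrM mulfK//.
  by congr _%:E; ring.
move=> L _; case: ifP => // _.
by rewrite lee_fin !mulr_ge0 ?invr_ge0 ?expR_ge0 ?exprn_ge0 ?powR_ge0 ?ltW.
Qed.
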